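(* Let $G$ be an abelian group. Let $A$ and $B$ be $\mathbb{Z}G$-modules whose additive groups are torsion-free abelian groups of finite rank. Suppose that $A$ does not contain a nontrivial submodule that is isomorphic to a submodule of $B$. Then there is a positive integer $m$ such that $$m\cdot \mathrm{Ext}^n_{\mathbb{Z}G}(A,B)=0\quad\text{and}\quad m\cdot \mathrm{Tor}_n^{\mathbb{Z}G}(A,B)=0$$ for all $n\geq 0$.
   Context: A section of a group is a quotient of one of its subgroups. An abelian group has finite rank if, for every prime $p$, each of its $p$-sections is a direct sum of finitely many cyclic and quasicyclic $p$-groups. The ring $\mathbb{Z}G$ is commutative here, and $\mathrm{Ext}$ and $\mathrm{Tor}$ are formed over this commutative ring. *)

(* Defs.v *)
From HB Require Import structures.
From mathcomp Require Import all_boot all_order all_algebra.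
From mathcomp Require Import finmap.
From mathcomp.multinomials Require Import xfinmap monalg.
From mathcomp.classical Require Import boolp functions.

Set Implicit Arguments.
Unset Strict Implicit.
Unset Printing Implicit Defensive.

Import GRing.Theory.
Local Open Scope ring_scope.
Local Open Scope quotient_scope.

(* The abelian group [G] is written additively, so the basis elements of
   [groupring G] multiply by [<< g >> * << h >> = << g + h >>].  The ring
   instance on [malg] itself is of no use here: it is restricted to monoids
   without nontrivial units. *)
Definition groupring (G : zmodType) : Type := {malg int[G]}.

HB.instance Definition _ (G : zmodType) := GRing.Zmodule.on (groupring G).

Section GroupRing.
Variable G : zmodType.
Implicit Types x y z : {malg int[G]}.

Definition gr_one : {malg int[G]} := << 0 >>.

Definition gr_mul x y : {malg int[G]} :=
  \sum_(g <- msupp x) \sum_(h <- msupp y) << x@_g * y@_h *g g + h >>.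

Lemma gr_mulw (d1 d2 : {fset G}) x y :
  (msupp x `<=` d1)%fset -> (msupp y `<=` d2)%fset ->
  gr_mul x y = \sum_(g <- d1) \sum_(h <- d2) << x@_g * y@_h *g g + h >>.
Proof.
move=> le1 le2; rewrite /gr_mul (big_fset_incl _ le1) /=.
  apply/eq_bigr => g _; apply/big_fset_incl => // h _ /mcoeff_outdom ->.
  by rewrite mulr0 monalgU0.
move=> g _ /mcoeff_outdom xg.
by rewrite big1 // => h _; rewrite xg mul0r monalgU0.
Qed.

Lemma gr_mulC : commutative gr_mul.
Proof.
move=> x y; rewrite /gr_mul exchange_big /=.
by apply/eq_bigr => g _; apply/eq_bigr => h _; rewrite mulrC addrC.
Qed.

Lemma gr_mulDl : left_distributive gr_mul +%R.
Proof.
move=> x y z; rewrite (gr_mulw (msuppD_le x y) (fsubset_refl _)).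
rewrite (gr_mulw (fsubsetUl (msupp x) (msupp y)) (fsubset_refl (msupp z))).
rewrite (gr_mulw (fsubsetUr (msupp x) (msupp y)) (fsubset_refl (msupp z))).
rewrite -big_split /=; apply/eq_bigr => g _.
rewrite -big_split /=; apply/eq_bigr => h _.
by rewrite mcoeffD mulrDl monalgUD.
Qed.

Lemma gr_mul0l : left_zero 0 gr_mul.
Proof. by move=> x; rewrite /gr_mul msupp0 big_seq_fset0. Qed.

Lemma gr_mulUU (a b : int) (g h : G) :
  gr_mul << a *g g >> << b *g h >> = << a * b *g g + h >>.
Proof. by rewrite (gr_mulw msuppU_le msuppU_le) !big_seq_fset1 !mcoeffUU. Qed.

Lemma gr_mul_suml I (r : seq I) (F : I -> {malg int[G]}) y :
  gr_mul (\sum_(i <- r) F i) y = \sum_(i <- r) gr_mul (F i) y.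
Proof.
by apply: (big_morph (gr_mul^~ y) (fun a b => gr_mulDl a b y) (gr_mul0l y)).
Qed.

Lemma gr_mul_sumr I (r : seq I) (F : I -> {malg int[G]}) y :
  gr_mul y (\sum_(i <- r) F i) = \sum_(i <- r) gr_mul y (F i).
Proof.
by rewrite gr_mulC gr_mul_suml; apply/eq_bigr => i _; rewrite gr_mulC.
Qed.

Lemma gr_mulA : associative gr_mul.
Proof.
move=> x y z; rewrite [x]monalgE !gr_mul_suml; apply/eq_bigr => g _.
rewrite [y]monalgE gr_mul_sumr !gr_mul_suml gr_mul_sumr; apply/eq_bigr => h _.
rewrite [z]monalgE !gr_mul_sumr; apply/eq_bigr => k _.
by rewrite !gr_mulUU mulrA addrA.
Qed.

Lemma gr_mul1l : left_id gr_one gr_mul.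
Proof.
move=> x; rewrite [x in gr_mul _ x]monalgE [RHS]monalgE gr_mul_sumr.
by apply/eq_bigr => g _; rewrite gr_mulUU mul1r add0r.
Qed.

Lemma gr_one_neq0 : gr_one != 0.
Proof. by rewrite monalgU_eq0. Qed.

End GroupRing.

HB.instance Definition _ (G : zmodType) :=
  GRing.Zmodule_isComNzRing.Build (groupring G)
    (@gr_mulA G) (@gr_mulC G) (@gr_mul1l G) (@gr_mulDl G) (@gr_one_neq0 G).

Definition subgrp (V : zmodType) (S : zmodClosed V) : Type := {x : V | x \in S}.

Section SubgrpInstances.
Variables (V : zmodType) (S : zmodClosed V).
HB.instance Definition _ := SubChoice.on (subgrp S).
HB.instance Definition _ := [SubChoice_isSubZmodule of subgrp S by <:].
End SubgrpInstances.

Definition submod (R : nzRingType) (V : lmodType R) (S : submodClosed V) : Type :=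
  {x : V | x \in S}.

Section SubmodInstances.
Variables (R : nzRingType) (V : lmodType R) (S : submodClosed V).
HB.instance Definition _ := SubChoice.on (submod S).
HB.instance Definition _ := [SubChoice_isSubLmodule of submod S by <:].
End SubmodInstances.

Definition grpker (U V : zmodType) (f : {additive U -> V}) : {pred U} :=
  [pred x | f x == 0].

Fact grpker_closed (U V : zmodType) (f : {additive U -> V}) :
  zmod_closed (grpker f).
Proof.
split=> [|x y]; rewrite !inE ?raddf0 // => /eqP fx /eqP fy.
by rewrite raddfB fx fy subrr.
Qed.

HB.instance Definition _ (U V : zmodType) (f : {additive U -> V}) :=
  GRing.isZmodClosed.Build U (grpker f) (grpker_closed f).

Definition modker (R : nzRingType) (U V : lmodType R) (f : {linear U -> V}) :
  {pred U} := [pred x | f x == 0].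

Fact modker_closed (R : nzRingType) (U V : lmodType R) (f : {linear U -> V}) :
  submod_closed (modker f).
Proof.
split=> [|a x y]; rewrite !inE ?linear0 // => /eqP fx /eqP fy.
by rewrite linearP fx fy scaler0 addr0.
Qed.

HB.instance Definition _ (R : nzRingType) (U V : lmodType R)
    (f : {linear U -> V}) :=
  GRing.isSubmodClosed.Build R U (modker f) (modker_closed f).

Definition boundaries (X Y Z : zmodType) (f : {additive X -> Y})
    (g : {additive Y -> Z}) : {pred subgrp (grpker g)} :=
  fun y => `[< exists x, f x = val y >].

Fact boundaries_closed (X Y Z : zmodType) (f : {additive X -> Y})
    (g : {additive Y -> Z}) : zmod_closed (@boundaries X Y Z f g).
Proof.
split=> [|y1 y2 /asboolP[x1 fx1] /asboolP[x2 fx2]]; apply/asboolP.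
  by exists 0; rewrite !raddf0.
by exists (x1 - x2); rewrite !raddfB fx1 fx2.
Qed.

HB.instance Definition _ (X Y Z : zmodType) (f : {additive X -> Y})
    (g : {additive Y -> Z}) :=
  GRing.isZmodClosed.Build (subgrp (grpker g)) (@boundaries X Y Z f g)
    (@boundaries_closed X Y Z f g).

(* [ker g / im f]; no condition [g \o f = 0] is imposed, the quotient being by
   [im f :&: ker g]. *)
Definition homology (X Y Z : zmodType) (f : {additive X -> Y})
    (g : {additive Y -> Z}) : zmodType := Quotient.quot (@boundaries X Y Z f g).

Lemma homology_annP (X Y Z : zmodType) (f : {additive X -> Y})
    (g : {additive Y -> Z}) (m : nat) :
  (forall x : homology f g, x *+ m = 0) <->
  (forall y, g y = 0 -> exists x, f x = y *+ m).
Proof.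
pose Q := Quotient.quot (@boundaries X Y Z f g).
have piE (z : subgrp (grpker g)) :
    (\pi_Q z *+ m == 0) = `[< exists x, f x = val z *+ m >].
  rewrite -raddfMn -(raddf0 (\pi_Q)) -Quotient.idealrBE subr0.
  by rewrite unfold_in /boundaries raddfMn.
split=> [H y /eqP gy|H x].
  by have := piE (Sub y gy); rewrite (H (\pi_Q _)) eqxx => /esym/asboolP.
rewrite -[x](reprK (x : Q)); apply/eqP; rewrite piE; apply/asboolP.
exact/H/eqP/(valP (repr (x : Q))).
Qed.

(* [{malg R[T]}] is the free [R]-module with basis the elements [<< t >>];
   [free_lift h] is the linear map with [<< t >> |-> h t]. *)
Definition free_lift (R : nzRingType) (T : choiceType) (V : lmodType R)
    (h : T -> V) (x : {malg R[T]}) : V := \sum_(t <- msupp x) x@_t *: h t.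

Section FreeLift.
Variables (R : nzRingType) (T : choiceType) (V : lmodType R) (h : T -> V).

Lemma free_liftw (d : {fset T}) (x : {malg R[T]}) : (msupp x `<=` d)%fset ->
  free_lift h x = \sum_(t <- d) x@_t *: h t.
Proof.
move=> le; rewrite /free_lift (big_fset_incl _ le) // => t _ /mcoeff_outdom ->.
by rewrite scale0r.
Qed.

Fact free_lift_linear : linear (free_lift h).
Proof.
move=> a x y; set d := (msupp x `|` msupp y)%fset.
have lex : (msupp x `<=` d)%fset by exact: fsubsetUl.
have ley : (msupp y `<=` d)%fset by exact: fsubsetUr.
have lexy : (msupp (a *: x + y)%R `<=` d)%fset.
  apply: fsubset_trans (msuppD_le _ _) _; apply/fsetSU/msuppZ_le.
rewrite (free_liftw lex) (free_liftw ley) (free_liftw lexy).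
rewrite scaler_sumr -big_split /=; apply/eq_bigr => t _.
by rewrite mcoeffD mcoeffZ scalerDl scalerA.
Qed.

HB.instance Definition _ :=
  GRing.isLinear.Build R {malg R[T]} V *:%R (free_lift h) free_lift_linear.

Lemma free_liftU t : free_lift h << t >> = h t.
Proof. by rewrite (free_liftw msuppU_le) big_seq_fset1 mcoeffUU scale1r. Qed.

End FreeLift.

Section HomTensor.
Variable R : comNzRingType.

Definition is_linear (U V : lmodType R) : {pred U -> V} :=
  fun f => `[< linear f >].

Fact is_linear_closed (U V : lmodType R) : zmod_closed (@is_linear U V).
Proof.
split=> [|f g /asboolP fl /asboolP gl]; apply/asboolP => a x y.
  by rewrite scaler0 addr0.
rewrite -[LHS]/(f (a *: x + y) - g (a *: x + y)).
rewrite -[RHS]/(a *: (f x - g x) + (f y - g y)).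
by rewrite fl gl scalerBr opprD addrACA.
Qed.

HB.instance Definition _ (U V : lmodType R) :=
  GRing.isZmodClosed.Build (U -> V) (@is_linear U V) (@is_linear_closed U V).

Definition Hom (U V : lmodType R) : zmodType := subgrp (@is_linear U V).

Fact hom_pre_subproof (U U' V : lmodType R) (f : {linear U' -> U})
  (phi : Hom U V) : val phi \o f \in @is_linear U' V.
Proof.
case: phi => phi /= /asboolP phil; apply/asboolP => a x y /=.
by rewrite linearP phil.
Qed.

Definition hom_pre (U U' V : lmodType R) (f : {linear U' -> U})
  (phi : Hom U V) : Hom U' V := Sub (val phi \o f) (hom_pre_subproof f phi).

Fact hom_pre_additive (U U' V : lmodType R) (f : {linear U' -> U}) :
  zmod_morphism (@hom_pre U U' V f).
Proof. by move=> phi psi; apply/val_inj. Qed.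

HB.instance Definition _ (U U' V : lmodType R) (f : {linear U' -> U}) :=
  GRing.isZmodMorphism.Build (Hom U V) (Hom U' V) (hom_pre f)
    (hom_pre_additive f).

Inductive tensor_relator (U V : lmodType R) : {malg R[(U * V)%type]} -> Prop :=
| TensorDl u u' v :
    tensor_relator (<< (u + u', v) >> - << (u, v) >> - << (u', v) >>)
| TensorDr u v v' :
    tensor_relator (<< (u, v + v') >> - << (u, v) >> - << (u, v') >>)
| TensorZl a u v : tensor_relator (<< (a *: u, v) >> - a *: << (u, v) >>)
| TensorZr a u v : tensor_relator (<< (u, a *: v) >> - a *: << (u, v) >>).

Definition tensor_rel (U V : lmodType R) : {pred {malg R[(U * V)%type]}} :=
  fun x => `[< forall S : submodClosed {malg R[(U * V)%type]},
                 (forall r, tensor_relator r -> r \in S) -> x \in S >].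

Fact tensor_rel_submod (U V : lmodType R) : submod_closed (@tensor_rel U V).
Proof.
split=> [|a x y /asboolP xS /asboolP yS]; apply/asboolP => S rS.
  exact: rpred0.
by rewrite rpredD ?rpredZ ?xS ?yS.
Qed.

HB.instance Definition _ (U V : lmodType R) :=
  GRing.isSubmodClosed.Build R {malg R[(U * V)%type]} (@tensor_rel U V)
    (@tensor_rel_submod U V).

Definition tensor (U V : lmodType R) : zmodType := Quotient.quot (@tensor_rel U V).

Definition tens (U V : lmodType R) (u : U) (v : V) : tensor U V :=
  \pi_(tensor U V) << (u, v) >>.

(* [tensor_map f] is the map [f (x) id], induced by [(u, v) |-> (f u, v)]. *)
Definition free_map (U U' V : lmodType R) (f : U -> U') :
    {malg R[(U * V)%type]} -> {malg R[(U' * V)%type]} :=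
  free_lift (fun uv => << (f uv.1, uv.2) >>).

HB.instance Definition _ (U U' V : lmodType R) (f : U -> U') :=
  GRing.Linear.on (@free_map U U' V f).

Lemma free_mapU (U U' V : lmodType R) (f : U -> U') (u : U) (v : V) :
  free_map f << (u, v) >> = << (f u, v) >>.
Proof. exact: free_liftU. Qed.

Definition tensor_map (U U' V : lmodType R) (f : {linear U -> U'})
  (x : tensor U V) : tensor U' V := \pi_(tensor U' V) (free_map f (repr x)).

Lemma free_map_rel (U U' V : lmodType R) (f : {linear U -> U'}) x :
  x \in @tensor_rel U V -> free_map f x \in @tensor_rel U' V.
Proof.
move=> /asboolP xS; apply/asboolP => S rS.
pose P : {pred {malg R[(U * V)%type]}} := [pred y | free_map f y \in S].
have Pclosed : submod_closed P.
  split=> [|a y z]; rewrite !inE ?linear0 ?rpred0 // => yS zS.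
  by rewrite linearP rpredD ?rpredZ.
pose HP := GRing.isSubmodClosed.Build R {malg R[(U * V)%type]} P Pclosed.
pose T : submodClosed {malg R[(U * V)%type]} := HB.pack P HP.
have fB y z : free_map f (y - z) = free_map f y - free_map f z.
  exact: (raddfB (free_map f)).
have fZ a y : free_map f (a *: y) = a *: free_map f y.
  exact: (linearZ_LR (free_map f)).
apply: (xS T) => r [u u' v|u v v'|a u v|a u v]; rewrite inE ?fB ?fZ !free_mapU.
- by rewrite (raddfD f); apply/rS/TensorDl.
- exact/rS/TensorDr.
- by rewrite (linearZ_LR f); apply/rS/TensorZl.
- exact/rS/TensorZr.
Qed.

Lemma tensor_map_pi (U U' V : lmodType R) (f : {linear U -> U'}) x :
  tensor_map f (\pi_(tensor U V) x) = \pi_(tensor U' V) (free_map f x).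
Proof.
apply/eqP; rewrite /tensor_map -Quotient.idealrBE -linearB /=.
by apply: free_map_rel; rewrite Quotient.idealrBE reprK.
Qed.

Lemma tensor_map_tens (U U' V : lmodType R) (f : {linear U -> U'}) u v :
  @tensor_map U U' V f (tens u v) = tens (f u) v.
Proof. by rewrite tensor_map_pi free_mapU. Qed.

Fact tensor_map_additive (U U' V : lmodType R) (f : {linear U -> U'}) :
  zmod_morphism (@tensor_map U U' V f).
Proof.
move=> x y; rewrite -[x]reprK -[y]reprK.
rewrite -(raddfB (\pi_(tensor U V))) !tensor_map_pi (raddfB (free_map f)).
exact: (raddfB (\pi_(tensor U' V))).
Qed.

HB.instance Definition _ (U U' V : lmodType R) (f : {linear U -> U'}) :=
  GRing.isZmodMorphism.Build (tensor U V) (tensor U' V) (tensor_map f)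
    (tensor_map_additive f).

End HomTensor.

Section ExtTor.
Variable R : comNzRingType.

(* The canonical free resolution of [M]
     ... --> Free M 1 --res_diff M 0--> Free M 0 --res_aug M--> M --> 0
   in which [Free M n] is the free module on the underlying set of the n-th
   syzygy module, and the next syzygy module is the kernel of the evaluation
   map of [Free M n] onto the n-th one. *)
Definition free_eval (M : lmodType R) : {malg R[M]} -> M := free_lift id.

HB.instance Definition _ (M : lmodType R) := GRing.Linear.on (@free_eval M).

Definition relmod (M : lmodType R) : lmodType R := submod (modker (@free_eval M)).

Definition rel_incl (M : lmodType R) : {linear relmod M -> {malg R[M]}} :=
  (val : submod (modker (@free_eval M)) -> _).

Lemma free_eval_surj (M : lmodType R) (y : M) : exists x, free_eval x = y.
Proof. by exists << y >>; apply: free_liftU. Qed.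

Lemma rel_incl_inj (M : lmodType R) : injective (@rel_incl M).
Proof. exact: val_inj. Qed.

Lemma rel_inclP (M : lmodType R) (x : {malg R[M]}) :
  free_eval x = 0 <-> exists z, rel_incl M z = x.
Proof.
split=> [/eqP x0|[z <-]]; last exact/eqP/(valP (z : submod _)).
by exists (Sub x x0 : submod (modker (@free_eval M))).
Qed.

Fixpoint syzygy (M : lmodType R) (n : nat) : lmodType R :=
  if n is n'.+1 then relmod (syzygy M n') else M.

Definition Free (M : lmodType R) (n : nat) : lmodType R := {malg R[syzygy M n]}.

Definition res_aug (M : lmodType R) : {linear Free M 0 -> M} := @free_eval M.

Definition res_diff (M : lmodType R) (n : nat) :
    {linear Free M n.+1 -> Free M n} :=
  rel_incl (syzygy M n) \o @free_eval (syzygy M n.+1).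

Lemma im_res_diff (M : lmodType R) n (x : Free M n) :
  (exists y, res_diff M n y = x) <-> @free_eval (syzygy M n) x = 0.
Proof.
split=> [[y <-]|/rel_inclP[z zx]].
  by apply/rel_inclP; exists (@free_eval (syzygy M n.+1) y).
have [y yz] := @free_eval_surj (syzygy M n.+1) z.
by exists y; rewrite -zx -yz.
Qed.

Lemma ker_res_diff (M : lmodType R) n (x : Free M n.+1) :
  res_diff M n x = 0 <-> @free_eval (syzygy M n.+1) x = 0.
Proof.
rewrite -[res_diff M n x]/(rel_incl _ (@free_eval (syzygy M n.+1) x)).
split=> [x0|->]; last exact: raddf0.
by apply: rel_incl_inj; rewrite x0 (raddf0 (rel_incl (syzygy M n))).
Qed.

Lemma res_exact0 (M : lmodType R) (x : Free M 0) :
  res_aug M x = 0 <-> exists y, res_diff M 0 y = x.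
Proof. by rewrite im_res_diff. Qed.

Lemma res_exact (M : lmodType R) n (x : Free M n.+1) :
  res_diff M n x = 0 <-> exists y, res_diff M n.+1 y = x.
Proof. by rewrite ker_res_diff im_res_diff. Qed.

Definition Ext (n : nat) (A B : lmodType R) : zmodType :=
  if n is n'.+1
  then homology (@hom_pre R _ _ B (res_diff A n'))
                (@hom_pre R _ _ B (res_diff A n'.+1))
  else homology (\0 : {additive Hom (Free A 0) B -> Hom (Free A 0) B})
                (@hom_pre R _ _ B (res_diff A 0)).

Definition Tor (n : nat) (A B : lmodType R) : zmodType :=
  if n is n'.+1
  then homology (@tensor_map R _ _ B (res_diff A n'.+1))
                (@tensor_map R _ _ B (res_diff A n'))
  else homology (@tensor_map R _ _ B (res_diff A 0))
                (\0 : {additive tensor (Free A 0) B -> tensor (Free A 0) B}).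

End ExtTor.

Definition torsion_free (V : zmodType) : Prop :=
  forall (x : V) (n : nat), (0 < n)%N -> x *+ n = 0 -> x = 0.

Definition p_group (p : nat) (V : zmodType) : Prop :=
  forall x : V, exists k : nat, x *+ (p ^ k) = 0.

Definition cyclic_group (V : zmodType) : Prop :=
  exists x : V, forall y : V, exists k : int, y = x *~ k.

(* The quasicyclic p-group is the group of type p^oo, with generators
   [c 0, c 1, ...] and relations [p c_0 = 0], [p c_(i+1) = c_i]; as [p] is prime,
   [c 0 != 0] rules out all proper quotients of that group. *)
Definition quasicyclic_group (p : nat) (V : zmodType) : Prop :=
  exists c : nat -> V,
    [/\ c 0 != 0, c 0 *+ p = 0, forall i, c i.+1 *+ p = c i
      & forall y : V, exists (i : nat) (k : int), y = c i *~ k].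

Definition internal_direct_sum (V : zmodType) (n : nat)
    (C : 'I_n -> zmodClosed V) : Prop :=
  (forall x : V, exists2 c : 'I_n -> V,
      forall i, c i \in C i & x = \sum_(i < n) c i) /\
  (forall c : 'I_n -> V,
      (forall i, c i \in C i) -> \sum_(i < n) c i = 0 -> forall i, c i = 0).

Definition finite_sum_of_cyclic_quasicyclic (p : nat) (V : zmodType) : Prop :=
  exists (n : nat) (C : 'I_n -> zmodClosed V), internal_direct_sum C /\
    forall i, p_group p (subgrp (C i)) /\
      (cyclic_group (subgrp (C i)) \/ quasicyclic_group p (subgrp (C i))).

Definition finite_rank (V : zmodType) : Prop :=
  forall (p : nat) (H : zmodClosed V) (K : zmodClosed (subgrp H)),
    prime p -> p_group p (Quotient.quot K) -> finite_sum_of_cyclic_quasicyclic p (Quotient.quot K).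

Definition isomorphic_modules (R : nzRingType) (U V : lmodType R) : Prop :=
  exists f : {linear U -> V}, bijective f.

Definition have_common_submodule (R : nzRingType) (A B : lmodType R) : Prop :=
  exists (S : submodClosed A) (T : submodClosed B),
    (exists2 x : A, x \in S & x != 0) /\
    isomorphic_modules (submod S) (submod T).

(* Main.v *)
Require Import Defs.
From HB Require Import structures.
From mathcomp Require Import all_boot all_order all_algebra.
From mathcomp Require Import zify ring.
From mathcomp.multinomials Require Import monalg.
From mathcomp.classical Require Import boolp classical_sets.

(* Let [R] be the group ring.  If [m = r + s] with [m > 0] an integer, [r A = 0]
   and [s B = 0], then [m] acts as [r] on [B]; as [r] is null-homotopic on the
   free resolution of [A], [m] kills [Ext] and [Tor].  If no such [m] exists, then
   [Ann A + Ann B] lies in a prime ideal [P] containing no positive integer.  Then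
   both [A] and [B] have an element with annihilator exactly [P], and these
   generate isomorphic submodules.  To find such an element in [A], start from an
   [x] with [Ann x] inside [P], which exists because [A] contains a finite
   subset with torsion cokernel.  Multiply [x] successively by ring elements so as
   to kill it by finitely many [p_i] in [P] such that the [p_i x] generate [P x] up
   to torsion, keeping [Ann x] inside [P]: this is possible since the powers of
   [p_i] applied to [x] are linearly dependent.  Finite rank enters through
   finiteness of independent sequences: an infinite one would span a free group [H]
   with [H / 2H] infinite. *)

Set Implicit Arguments.
Unset Strict Implicit.
Unset Printing Implicit Defensive.

Import GRing.Theory.
Local Open Scope ring_scope.
Local Open Scope quotient_scope.

(** * Annihilators and homology *)

Lemma malg_scaleU (R : nzRingType) (T : choiceType) (c : R) (t : T) :
  << c *g t >> = c *: << t >> :> {malg R[T]}.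
Proof. by apply/malgP => u; rewrite mcoeffZ !mcoeffU mulrnAr mulr1. Qed.

Lemma free_linear_ext (R : nzRingType) (T : choiceType) (V : lmodType R)
    (f g : {linear {malg R[T]} -> V}) :
  (forall t, f << t >> = g << t >>) -> f =1 g.
Proof.
move=> fg x; rewrite [x]monalgE !raddf_sum; apply: eq_bigr => t _.
by rewrite malg_scaleU /= !linearZ_LR fg.
Qed.

(** Projectivity of free modules: preimages are chosen on the basis and extended linearly. *)
Lemma free_linear_lift (R : nzRingType) (T : choiceType) (U V : lmodType R)
    (d : {linear U -> V}) (g : {linear {malg R[T]} -> V}) :
  (forall x, exists y, d y = g x) ->
  exists k : {linear {malg R[T]} -> U}, forall x, d (k x) = g x.
Proof.
move=> dg; have [h hP] := choice (fun t => dg << t >>).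
exists (free_lift h) => x.
apply: (@free_linear_ext R T V (d \o free_lift h) g) => t /=.
by rewrite free_liftU.
Qed.

Definition linear_of_Hom (R : comNzRingType) (U V : lmodType R)
    (phi : Defs.Hom U V) : {linear U -> V} :=
  HB.pack (val phi)
    (GRing.isLinear.Build R U V *:%R (val phi) (asboolW (valP phi))).

(** * Calculus of pure tensors *)

Section TensorCalculus.
Variable R : comNzRingType.

Lemma tensor_pi_rel (U V : lmodType R) (x y : {malg R[(U * V)%type]}) :
  tensor_relator (x - y) -> \pi_(tensor U V) x = \pi_(tensor U V) y.
Proof.
move=> xy; apply/eqP; rewrite -Quotient.idealrBE.
by apply/asboolP => S; apply.
Qed.

Lemma tensDl (U V : lmodType R) (u u' : U) (v : V) :
  tens (u + u') v = tens u v + tens u' v.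
Proof.
rewrite /tens -(raddfD (\pi_(tensor U V))); apply: tensor_pi_rel.
by rewrite opprD addrA; apply: TensorDl.
Qed.

Lemma tensZ (U V : lmodType R) a (u : U) (v : V) :
  tens (a *: u) v = tens u (a *: v).
Proof.
rewrite /tens (tensor_pi_rel (TensorZl a u v)).
by rewrite (tensor_pi_rel (TensorZr a u v)).
Qed.

Lemma tensDr (U V : lmodType R) (u : U) (v v' : V) :
  tens u (v + v') = tens u v + tens u v'.
Proof.
rewrite /tens -(raddfD (\pi_(tensor U V))); apply: tensor_pi_rel.
by rewrite opprD addrA; apply: TensorDr.
Qed.

Lemma tens0r (U V : lmodType R) (u : U) : tens u (0 : V) = 0.
Proof. by apply: (addIr (tens u (0 : V))); rewrite -tensDr !add0r. Qed.

Lemma tensMn (U V : lmodType R) (u : U) (v : V) n :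
  tens u (v *+ n) = tens u v *+ n.
Proof. by elim: n => [|n IH]; rewrite ?tens0r // !mulrS tensDr IH. Qed.

Lemma tensor_ind (U V : lmodType R) (P : tensor U V -> Prop) :
  P 0 -> (forall x y, P x -> P y -> P (x + y)) -> (forall u v, P (tens u v)) ->
  forall x, P x.
Proof.
move=> P0 PD Pt x; rewrite -[x]reprK [repr x]monalgE raddf_sum.
apply: (big_ind P) => // -[u v] _; rewrite malg_scaleU /=.
by rewrite -(tensor_pi_rel (TensorZl _ u v)); apply: Pt.
Qed.

End TensorCalculus.

(** * Null-homotopy of multiplication by [r] *)

Section Homotopy.
Variables (R : comNzRingType) (A : lmodType R) (r : R).
Hypothesis rA : forall a : A, r *: a = 0.

Lemma homotopy0 :
  exists k : {linear Free A 0 -> Free A 1},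
    forall x, res_diff A 0 (k x) = r *: x.
Proof.
apply: (@free_linear_lift R _ _ _ (res_diff A 0) (r \*: idfun)) => x /=.
by apply/res_exact0; rewrite linearZ_LR rA.
Qed.

(** The pair satisfies d k' + k d = r. If d k d = r d, then r - k d takes values in cycles and so
    lifts through d. Each [k'] serves as the next [k], since d k' d = r d - k d d = r d. *)
Lemma homotopyS n : 
  exists (k : {linear Free A n -> Free A n.+1})
         (k' : {linear Free A n.+1 -> Free A n.+2}),
    forall x, res_diff A n.+1 (k' x) = r *: x - k (res_diff A n x).
Proof.
have dd m x : res_diff A m (res_diff A m.+1 x) = 0.
  by apply/res_exact; exists x.
have step m (k : {linear Free A m -> Free A m.+1}) :
    (forall y, res_diff A m (k (res_diff A m y)) = r *: res_diff A m y) ->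
    exists k' : {linear Free A m.+1 -> Free A m.+2},
      forall x, res_diff A m.+1 (k' x) = r *: x - k (res_diff A m x).
  move=> kP; pose g : {linear _ -> _} := (r \*: idfun) \- (k \o res_diff A m).
  apply: (@free_linear_lift R _ _ _ (res_diff A m.+1) g) => x.
  apply/res_exact; have -> : g x = r *: x - k (res_diff A m x) by [].
  by rewrite linearB linearZ_LR kP subrr.
elim: n => [|n [k [k' kP]]].
  by have [k kP] := homotopy0; exists k; apply: step => y; rewrite kP.
by exists k'; apply: step => y; rewrite kP dd linear0 subr0.
Qed.

Variables (B : lmodType R) (m : nat).
Hypothesis mB : forall b : B, b *+ m = r *: b.

Lemma Hom_mulrn (U : lmodType R) (phi : Defs.Hom U B) x :
  val (phi *+ m) x = linear_of_Hom phi (r *: x).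
Proof.
rewrite linearZ_LR -mB /=.
by elim: m => [//|i IH]; rewrite !mulrS -IH.
Qed.

Lemma annihilator_Ext n (x : Ext n A B) : x *+ m = 0.
Proof.
case: n x => [|n]; apply/homology_annP => phi phi0.
  (* In degree 0 the incoming map is zero, so [phi *+ m] itself must vanish. *)
  exists 0; apply/val_inj/funext => x; rewrite Hom_mulrn.
  have [k kP] := homotopy0; rewrite -kP.
  by have /(congr1 val)/(congr1 (@^~ (k x))) := phi0.
have [k [k' kP]] := homotopyS n.
have phid y : linear_of_Hom phi (res_diff A n.+1 y) = 0.
  by have /(congr1 val)/(congr1 (@^~ y)) := phi0.
have fl : linear_of_Hom phi \o k \in @is_linear R (Free A n) B.
  apply/asboolP => a u v.
  by rewrite -[LHS]/(linear_of_Hom phi (k (a *: u + v))) !linearP.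
(* For a cocycle phi, phi r = phi d k' + phi k d = (phi k) d, so m phi is the coboundary of phi
   k. *)
exists (Sub (linear_of_Hom phi \o k) fl); apply/val_inj/funext => x.
rewrite Hom_mulrn /=; have := phid (k' x).
by rewrite kP linearB => /subr0_eq.
Qed.

Lemma tensor_mulrn (U : lmodType R) (u : U) (b : B) :
  tens (r *: u) b = tens u b *+ m.
Proof. by rewrite tensZ -mB tensMn. Qed.

Lemma tensor_additive_mulrn (U : lmodType R)
    (f : {additive tensor U B -> tensor U B}) :
  (forall u b, f (tens u b) = tens (r *: u) b) -> forall x, f x = x *+ m.
Proof.
move=> fr; apply: tensor_ind => [|x y fx fy|u b].
- by rewrite raddf0 mul0rn.
- by rewrite raddfD mulrnDl fx fy.
- by rewrite fr tensor_mulrn.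
Qed.

Lemma annihilator_Tor n (x : Tor n A B) : x *+ m = 0.
Proof.
case: n x => [|n]; apply/homology_annP => y y0.
  have [k kP] := homotopy0; exists (tensor_map k y).
  pose f : {additive _ -> _} :=
    @tensor_map R _ _ B (res_diff A 0) \o tensor_map k.
  apply: (tensor_additive_mulrn (f := f)) => u v.
  by rewrite /f /= !tensor_map_tens kP.
have [k [k' kP]] := homotopyS n; exists (tensor_map k' y).
(* The map induced by d k' + k d is multiplication by [m], and its second summand kills the cycle
   [y]. *)
pose f : {additive _ -> _} :=
  (@tensor_map R _ _ B (res_diff A n.+1) \o tensor_map k')
  \+ (tensor_map k \o tensor_map (res_diff A n)).
have <- : f y = y *+ m.
  apply: tensor_additive_mulrn => u v; rewrite /f /=.
  by rewrite !tensor_map_tens -tensDl kP subrK.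
by rewrite /f /= y0 raddf0 addr0.
Qed.

End Homotopy.

(** * Groups of finite rank *)

(** The integer span of [s], in recursive form so that the coefficient of the head splits off. *)
Fixpoint zspan (V : zmodType) (s : seq V) (x : V) : Prop :=
  if s is v :: s' then exists c : int, zspan s' (x - v *~ c) else x = 0.

Section Zspan.
Variable V : zmodType.
Implicit Types (s : seq V) (x y : V).

Lemma zspan0 s : zspan s 0.
Proof. by elim: s => [//|v s IH]; exists 0; rewrite mulr0z subr0. Qed.

Lemma zspanB s x y : zspan s x -> zspan s y -> zspan s (x - y).
Proof.
elim: s x y => [|v s IH] x y /=; first by move=> -> ->; rewrite subr0.
move=> [c xc] [d yd]; exists (c - d); rewrite mulrzBr.
by have := IH _ _ xc yd; rewrite !opprD !opprK addrACA.
Qed.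

Lemma zspanN s x : zspan s x -> zspan s (- x).
Proof. by rewrite -sub0r; apply/zspanB/zspan0. Qed.

Lemma zspanD s x y : zspan s x -> zspan s y -> zspan s (x + y).
Proof. by move=> xs /zspanN ys; rewrite -[y]opprK; apply: zspanB. Qed.

Lemma zspan_cons v s x : zspan s x -> zspan (v :: s) x.
Proof. by move=> xs; exists 0; rewrite mulr0z subr0. Qed.

Lemma zspan_head v s : zspan (v :: s) v.
Proof. by exists 1; rewrite subrr; apply: zspan0. Qed.

Lemma zspan_ind (P : V -> Prop) s x :
  P 0 -> (forall y z, P y -> P z -> P (y - z)) -> (forall v, v \in s -> P v) ->
  zspan s x -> P x.
Proof.
move=> P0 PB; have PN y : P y -> P (- y) by rewrite -sub0r; apply: PB.
have PD y z : P y -> P z -> P (y + z).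
  by move=> Py /PN Pz; rewrite -[z]opprK; apply: PB.
have Pz y (c : int) : P y -> P (y *~ c).
  move=> Py; have Pn (n : nat) : P (y *+ n).
    by elim: n => [//|n IH]; rewrite mulrS; apply: PD.
  by case: c => n; [exact: Pn|apply/PN/Pn].
elim: s x => [|v s IH] x sP /= => [->//|[c /IH xc]].
rewrite -[x](subrK (v *~ c)); apply: PD; last by apply/Pz/sP/mem_head.
by apply: xc => w ws; apply: sP; rewrite inE ws orbT.
Qed.

(** Dependence over the rationals: [x] is torsion modulo the span of [s]. *)
Definition zdep s x : Prop := exists2 k : nat, (0 < k)%N & zspan s (x *+ k).

Lemma zdep_mulrz s x (c : int) : c != 0 -> zspan s (x *~ c) -> zdep s x.
Proof.
case: c => [[//|n]|n] _ xc; exists n.+1 => //.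
by rewrite -[_ *+ _]opprK; apply: zspanN.
Qed.

End Zspan.

Section FiniteSum.
Variable V : zmodType.
Hypotheses (Vfin : finite_sum_of_cyclic_quasicyclic 2 V).
Hypothesis V2 : forall x : V, x *+ 2 = 0.

(** A quasicyclic summand cannot occur, since c_0 = 2 c_1 = 0, and a cyclic one has at most two
    elements, so n bits encode each element of [V]. *)
Lemma elementary_sum_bounded :
  exists N : nat, forall f : nat -> V, ~ {in gtn N &, injective f}.
Proof.
have mulz (x : V) (k : int) : exists b : bool, x *~ k = x *+ b.
  have xn (n : nat) : x *+ n = x *+ odd n.
    rewrite -[in LHS](odd_double_half n) mulrnDr -mul2n mulrnA V2 mul0rn.
    by rewrite addr0.
  have x2 (y : V) : - y = y.
    by apply/eqP; rewrite -subr_eq0 -opprD -mulr2n V2 oppr0.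
  case: k => n; first by exists (odd n); apply: xn.
  by exists (odd n.+1); rewrite NegzE mulrNz x2; apply: xn.
have [n [C [[Csum Cfree] Ccyc]]] := Vfin.
have gen i : exists g : V, forall y, y \in C i -> exists b : bool, y = g *+ b.
  have [_ [[g gP]|[c [c0 c1 cS cP]]]] := Ccyc i.
    exists (val g) => y yC; have [k yk] := gP (Sub y yC).
    rewrite -[y]/(val (Sub y yC : subgrp (C i))) yk.
    by rewrite (raddfMz (val : subgrp (C i) -> V)); apply: mulz.
  case/eqP: c0; rewrite -(cS 0); apply/val_inj.
  by rewrite (raddfMn (val : subgrp (C i) -> V)) V2.
have [g gP] := choice gen.
have repr (x : V) : exists b : {ffun 'I_n -> bool}, x = \sum_i g i *+ b i.
  have [c cC ->] := Csum x.
  have [b bP] := choice (fun i => gP i _ (cC i)).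
  by exists (finfun b); apply: eq_bigr => i _; rewrite ffunE -bP.
have [b bP] := choice repr.
exists (#|{ffun 'I_n -> bool}|).+1 => f finj.
suff /leq_card : injective (fun i : 'I_(#|{ffun 'I_n -> bool}|).+1 => b (f i)).
  by rewrite card_ord ltnn.
move=> i j /= bij; apply/val_inj/finj => [||/=].
- exact: ltn_ord i.
- exact: ltn_ord j.
- by rewrite (bP (f i)) (bP (f j)) bij.
Qed.

End FiniteSum.

Section FiniteRank.
Variable V : zmodType.
Hypothesis Vfr : finite_rank V.

Section IndependentSequence.
Variable x : nat -> V.
(** The newest term comes first, where [zspan] splits off its coefficient. *)
Let X n := rev (mkseq x n).
Hypothesis xdep : forall n, ~ zdep (rev (mkseq x n)) (x n).

Let XS n : X n.+1 = x n :: X n.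
Proof. by rewrite /X mkseqS rev_rcons. Qed.

Let Xsub m n y : (m <= n)%N -> zspan (X m) y -> zspan (X n) y.
Proof.
move=> /subnK <-; elim: (n - m)%N => [//|d IH] ym.
by rewrite addSn XS; apply/zspan_cons/IH.
Qed.

Let H : {pred V} := fun y => `[< exists n, zspan (X n) y >].

Fact indep_span_closed : zmod_closed H.
Proof.
split=> [|y z /asboolP[m ym] /asboolP[n zn]]; apply/asboolP; first by exists 0.
exists (maxn m n); apply: zspanB.
  exact: Xsub (leq_maxl _ _) ym.
exact: Xsub (leq_maxr _ _) zn.
Qed.

(** This makes the [x j] distinct modulo doubles. Independence removes from [y] the terms beyond
    [x j] one by one; comparing coefficients at [x j] would then give 2c = 1. *)
Lemma indep_not_double n j y z : zspan (X n) y -> zspan (X j) z ->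
  y *+ 2 <> x j + z.
Proof.
move=> yn zj; have {yn} : zspan (X (n + j.+1)) y.
  by apply: Xsub yn; apply: leq_addr.
elim: n => [|n IH] /=.
  rewrite add0n XS /= => -[c yc] y2.
  apply: (@xdep j); apply: (@zdep_mulrz _ _ _ (1 - c *+ 2)).
    by apply/eqP; lia.
  have -> : x j *~ (1 - c *+ 2) = (y - x j *~ c) *+ 2 - z.
    by rewrite mulrzBr mulr2n mulrzDr mulrnBl y2 mulr2n addrAC addrK.
  by rewrite mulr2n; apply: zspanB => //; apply: zspanD.
rewrite addSn XS /= => -[c yc] y2.
apply: IH => //; have [c0|c0] := eqVneq c 0.
  by rewrite c0 mulr0z subr0 in yc.
case: (@xdep (n + j.+1)); apply: (@zdep_mulrz _ _ _ (c *+ 2)).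
  by apply: contraNneq c0; lia.
have -> : x (n + j.+1)%N *~ (c *+ 2) =
    x j + z - (y - x (n + j.+1)%N *~ c) - (y - x (n + j.+1)%N *~ c).
  rewrite -y2 !mulr2n mulrzDr -addrA -opprD [X in - X]addrACA opprD addrA.
  by rewrite subrr add0r opprD !opprK.
apply: zspanB => //; apply: zspanB => //; apply: zspanD.
  by apply: (@Xsub j.+1); rewrite ?leq_addl // XS; apply: zspan_head.
by apply: Xsub zj; lia.
Qed.

HB.instance Definition _ := GRing.isZmodClosed.Build V H indep_span_closed.

Let K : {pred subgrp H} := fun y => `[< exists z : subgrp H, y = z *+ 2 >].

Fact double_closed : zmod_closed K.
Proof.
split=> [|y z /asboolP[u ->] /asboolP[v ->]]; apply/asboolP.
  by exists 0; rewrite mul0rn.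
by exists (u - v); rewrite mulrnBl.
Qed.

HB.instance Definition _ := GRing.isZmodClosed.Build (subgrp H) K double_closed.

Lemma indep_sequence_False : False.
Proof.
(* This is H / 2H, a 2-section in which the classes of the [x n] are pairwise distinct, against its
   bounded size. *)
pose Q := Quotient.quot K.
have Q2 (y : Q) : y *+ 2 = 0.
  rewrite -[y]reprK -raddfMn -(raddf0 (\pi_Q)); apply/eqP.
  by rewrite -Quotient.idealrBE subr0; apply/asboolP; exists (repr y).
have Qp : p_group 2 Q by move=> y; exists 1%N; rewrite expn1 Q2.
have [N noinj] := elementary_sum_bounded (Vfr (p := 2) isT Qp) Q2.
have xH n : x n \in H.
  by apply/asboolP; exists n.+1; rewrite XS; apply: zspan_head.
pose h n : subgrp H := Sub (x n) (xH n).
suff ne i j : (i < j)%N -> \pi_Q (h i) <> \pi_Q (h j).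
  apply: (noinj (fun n => \pi_Q (h n))) => i j _ _ hij.
  by have [/ne|/ne|//] := ltngtP i j; rewrite hij.
move=> ij /esym/eqP; rewrite -Quotient.idealrBE => /asboolP[z].
move/(congr1 (val : subgrp H -> V)).
rewrite (raddfB (val : subgrp H -> V)) (raddfMn (val : subgrp H -> V)) /= => hz.
have /asboolP[n zn] := valP z.
apply: (indep_not_double zn _ (esym hz)).
apply: zspanN; apply: Xsub ij _; rewrite XS; apply: zspan_head.
Qed.

End IndependentSequence.

(** Otherwise a greedy choice inside [P] would yield an infinite independent sequence. *)
Lemma finite_rank_span (P : V -> Prop) :
  exists2 s : seq V, (forall v, v \in s -> P v) & forall v, P v -> zdep s v.
Proof.
apply: contrapT => nos.
(* The condition on [s] stands inside the existential, so that [choice] gives a function on all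
   lists; 0 is the default for lists outside [P]. *)
have next (s : seq V) :
    exists v, (forall v, v \in s -> P v) -> P v /\ ~ zdep s v.
  apply: contrapT => nov; apply: nos; exists s.
    by apply: contrapT => nsP; apply: nov; exists 0 => /nsP.
  move=> v Pv; apply: contrapT => nv; apply: nov; exists v => _; split => //.
have [e eP] := choice next.
pose t n := iter n (fun s => e s :: s) [::].
have tP n : forall v, v \in t n -> P v.
  elim: n => [//|n IH] v; rewrite inE => /predU1P[->|/IH//].
  by have [] := eP _ IH.
have tE n : t n = rev (mkseq (fun n => e (t n)) n).
  by elim: n => [//|n IH]; rewrite mkseqS rev_rcons -IH.
apply: (@indep_sequence_False (fun n => e (t n))) => n.
by rewrite -tE; have [] := eP _ (tP n).
Qed.

End FiniteRank.

(** * Prime annihilators *)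

(** Once [P] is inhabited, this is a prime ideal whose residue ring has characteristic 0; properness
    is [prime_nat] at 1. *)
Record char0_prime (R : comNzRingType) (P : R -> Prop) : Prop := Char0Prime {
  prime_add : forall x y, P x -> P y -> P (x + y);
  prime_scale : forall r x, P x -> P (r * x);
  prime_mul : forall x y, P (x * y) -> P x \/ P y;
  prime_nat : forall n : nat, (0 < n)%N -> ~ P n%:R }.

(** An ideal maximal among those containing [I] and no positive integer is prime: if adjoining x
    yields a positive integer n and adjoining y yields k, then adjoining xy yields nk. *)
Lemma char0_prime_exists (R : comNzRingType) (I : R -> Prop) :
  (forall x y, I x -> I y -> I (x + y)) ->
  (forall r x, I x -> I (r * x)) -> I 0 ->
  (forall n : nat, (0 < n)%N -> ~ I n%:R) ->
  exists2 P : R -> Prop, char0_prime P & forall x, I x -> P x.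
Proof.
move=> ID IM I0 In.
(* Closure under adding [I], rather than containing [I], lets the union of the
   empty chain be good. *)
pose good (J : set R) := [/\ forall x y, J x -> J y -> J (x + y),
  forall r x, J x -> J (r * x), forall x y, J x -> I y -> J (x + y)
  & forall n : nat, (0 < n)%N -> ~ J n%:R].
have [F Fgood Ftot|M [[MD MM MI Mn] Mmax]] := @Zorn_bigcup R good.
  split.
  - move=> x y [J FJ Jx] [K FK Ky].
    have [JK|KJ] := Ftot _ _ FJ FK.
      have [KD _ _ _] := Fgood _ FK.
      by exists K => //; apply: KD => //; apply: JK.
    have [JD _ _ _] := Fgood _ FJ.
    by exists J => //; apply: JD => //; apply: KJ.
  - move=> r x [J FJ Jx]; have [_ JM _ _] := Fgood _ FJ.
    by exists J => //; apply: JM.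
  - move=> x y [J FJ Jx] Iy; have [_ _ JI _] := Fgood _ FJ.
    by exists J => //; apply: JI.
  - by move=> n n0 [J FJ Jn]; have [_ _ _ Jnn] := Fgood _ FJ; apply: Jnn Jn.
(* Without 0, [M] would be empty and [I] a strictly larger good set. *)
have M0 : M 0.
  apply: contrapT => nM0; apply: (Mmax I); last by split.
  have Mempty x : ~ M x by move=> /(MM 0); rewrite mul0r.
  by split=> [x /Mempty //|IM']; apply/nM0/IM'.
have IsubM x : I x -> M x by rewrite -{2}[x]add0r; apply: MI.
have inv t : ~ M t -> exists r (n : nat), (0 < n)%N /\ M (n%:R + r * t).
  move=> nMt; apply: contrapT => nr.
  apply: (Mmax (fun x => exists2 r, M (x + r * t) & True)).
    split=> [x Mx|Msup]; first by exists 0; rewrite ?mul0r ?addr0.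
    by apply/nMt/Msup; exists (-1); rewrite ?mulN1r ?subrr.
  split.
  - move=> x y [r Mx _] [s My _]; exists (r + s) => //.
    by rewrite mulrDl addrACA; apply: MD.
  - move=> s x [r Mx _]; exists (s * r) => //.
    by rewrite -mulrA -mulrDr; apply: MM.
  - move=> x y [r Mx _] Iy; exists r => //; rewrite addrAC; exact: MI.
  - by move=> n n0 [r Mnr _]; apply: nr; exists r, n.
exists M => //; split=> // x y Mxy; apply: contrapT => /not_orP[nx ny].
have [r [n [n0 Mx]]] := inv _ nx; have [s [k [k0 My]]] := inv _ ny.
apply: (Mn (n * k)%N); first by rewrite muln_gt0 n0.
have -> : (n * k)%:R = k%:R * (n%:R + r * x) + (- (r * x)) * (k%:R + s * y)
   + r * s * (x * y) by rewrite natrM; ring.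
by apply/MD; [apply/MD|]; apply/MM.
Qed.

Section PrimeAnnihilator.
Variables (R : comNzRingType) (P : R -> Prop) (A : lmodType R).
Hypothesis Pprime : char0_prime P.
Hypotheses (Atf : torsion_free A) (Afr : finite_rank A).

Let P1 : ~ P 1.
Proof. exact: (@prime_nat _ _ Pprime 1). Qed.

(** Equivalently, [x] has nonzero image in the localisation at [P]. *)
Let ann_in (x : A) := forall r, r *: x = 0 -> P r.

Let not_ann_in x : ~ ann_in x -> exists2 t, ~ P t & t *: x = 0.
Proof.
move=> nx; apply: contrapT => nt; apply: nx => r rx.
by apply: contrapT => nr; apply: nt; exists r.
Qed.

Let ann_inZ t x : ~ P t -> ann_in x -> ann_in (t *: x).
Proof.
by move=> nt xP r; rewrite scalerA => /xP/(prime_mul Pprime)[|/nt].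
Qed.

(** Otherwise each member of a finite set spanning A up to torsion is killed by an element outside
    [P]. The product of these lies outside [P], yet kills A by torsion-freeness. *)
Lemma exists_ann_in : (forall r, (forall a : A, r *: a = 0) -> P r) ->
  exists x, ann_in x.
Proof.
move=> AP; apply: contrapT => /forallNP nx.
have [s _ sP] := finite_rank_span Afr (fun=> True).
have [t nt ts] : exists2 t, ~ P t & forall v, v \in s -> t *: v = 0.
  elim: s {sP} => [|v s [t nt ts]]; first by exists 1.
  have [u nu uv] := not_ann_in (nx v); exists (u * t).
    by case/(prime_mul Pprime).
  move=> w; rewrite inE => /predU1P[->|/ts tw].
    by rewrite mulrC -scalerA uv scaler0.
  by rewrite -scalerA tw scaler0.
apply/nt/AP => a; have [k k0 ak] := sP a I.
apply: (Atf k0); rewrite scalerMnr.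
apply: zspan_ind ts ak; first exact: scaler0.
by move=> y z ty tz; rewrite scalerBr ty tz subrr.
Qed.

(** Induction on f = g X + c. As f(p) and p lie in [P], so does c, whence c = 0 and g(p) kills p x.
    Either p x has annihilator inside [P] and replaces x, or some t outside [P] kills p x and t x is
    the element sought. *)
Lemma ann_in_root p (f : {poly int}) x : P p -> f != 0 -> ann_in x ->
  (map_poly intr f).[p] *: x = 0 ->
  exists2 r, ann_in (r *: x) & p *: (r *: x) = 0.
Proof.
move=> Pp; elim/poly_ind: f x => [|f c IH] x; first by rewrite eqxx.
rewrite rmorphD rmorphM /= map_polyX map_polyC hornerMXaddC => fc0 xP fcx.
have Pc : P c%:~R.
  rewrite -[_%:~R](addKr ((map_poly intr f).[p] * p)) -mulNr.
  by apply: (prime_add Pprime); [apply: (prime_scale Pprime)|apply: xP].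
have c0 : c = 0.
  case: c Pc {fc0 fcx} => [[//|n]|n].
    by move/(@prime_nat _ _ Pprime n.+1 isT).
  move/(prime_scale Pprime (-1)); rewrite NegzE mulrNz mulrNN mul1r.
  by move/(@prime_nat _ _ Pprime n.+1 isT).
rewrite c0 addr0 mulf_eq0 negb_or in fc0; have /andP[f0 _] := fc0.
rewrite c0 addr0 -scalerA in fcx.
have [pxP|/not_ann_in[t nt tpx]] := pselect (ann_in (p *: x)).
  have [r rP rp] := IH _ f0 pxP fcx.
  by exists (r * p); rewrite -scalerA.
exists t; first exact: ann_inZ.
by rewrite scalerA mulrC -scalerA.
Qed.

Lemma ann_in_kill p x : P p -> ann_in x ->
  exists2 r, ann_in (r *: x) & p *: (r *: x) = 0.
Proof.
move=> Pp xP.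
have [s sX sP] := finite_rank_span Afr (fun v => exists i, v = p ^+ i *: x).
have [N sN] : exists N, forall v, v \in s ->
    exists2 i, (i < N)%N & v = p ^+ i *: x.
  elim: s sX {sP} => [|v s IH] sX; first by exists 0%N.
  have [|N NP] := IH; first by move=> w ws; apply: sX; rewrite inE ws orbT.
  have [i vi] := sX _ (mem_head _ _); exists (maxn i.+1 N) => w.
  rewrite inE => /predU1P[->|/NP[j jN wj]].
    by exists i; rewrite ?leq_maxl.
  by exists j => //; rewrite leq_max jN orbT.
have [|k k0 kN] := sP (p ^+ N *: x); first by exists N.
pose low y := exists2 q : {poly int}, (size q <= N)%N &
  y = (map_poly intr q).[p] *: x.
have [q qN qE] : low (p ^+ N *: x *+ k).
  apply: zspan_ind kN.
  - by exists 0; rewrite ?size_poly0 // rmorph0 horner0 scale0r.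
  - move=> y z [f fN ->] [g gN ->]; exists (f - g).
      by rewrite (leq_trans (size_polyD _ _)) // size_polyN geq_max fN.
    by rewrite rmorphB hornerD hornerN scalerBl.
  - move=> v /sN[i iN ->]; exists 'X^i; first by rewrite size_polyXn.
    by rewrite map_polyXn hornerXn.
apply: (@ann_in_root _ ('X^N *+ k - q)) => //.
  (* The coefficient at N is k, since [q] has degree below N. *)
  apply/eqP => /(congr1 (fun f : {poly int} => f`_N)).
  rewrite coefB coefMn coefXn eqxx (nth_default _ qN) subr0 coef0; lia.
rewrite rmorphB rmorphMn /= map_polyXn hornerD hornerN hornerMn hornerXn.
by rewrite scalerBl -scalerMnl qE subrr.
Qed.

(** By commutativity a later factor keeps what earlier ones killed; torsion-freeness then passes
    from the finitely many p_i x to all of P x. *)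
Lemma prime_annihilator : (forall r, (forall a : A, r *: a = 0) -> P r) ->
  exists x : A, forall r, r *: x = 0 <-> P r.
Proof.
move=> /exists_ann_in[x xP].
have [s sX sP] := finite_rank_span Afr (fun v => exists2 p, P p & v = p *: x).
have [r rxP rs] : exists2 r, ann_in (r *: x) & forall v, v \in s -> r *: v = 0.
  elim: s sX {sP} => [|v s IH] sX; first by exists 1; rewrite ?scale1r.
  have [|r rxP rs] := IH; first by move=> w ws; apply: sX; rewrite inE ws orbT.
  have [p Pp ->] := sX _ (mem_head _ _).
  have [t tP tp] := ann_in_kill Pp rxP.
  exists (t * r); first by rewrite -scalerA.
  move=> w; rewrite inE => /predU1P[->|/rs rw].
    by rewrite scalerA mulrC -!scalerA.
  by rewrite -scalerA rw scaler0.
exists (r *: x) => p; split=> [/rxP //|Pp].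
have [|k k0 pk] := sP (p *: x); first by exists p.
apply: (Atf k0); rewrite scalerA mulrC -scalerA scalerMnr.
apply: zspan_ind rs pk; first exact: scaler0.
by move=> y z ry rz; rewrite scalerBr ry rz subrr.
Qed.

End PrimeAnnihilator.

(** * Cyclic submodules with equal annihilators *)

Definition cyclic_submod (R : nzRingType) (V : lmodType R) (x : V) : {pred V} :=
  fun v => `[< exists r, v = r *: x >].

Fact cyclic_submod_closed (R : nzRingType) (V : lmodType R) (x : V) :
  submod_closed (cyclic_submod x).
Proof.
split=> [|a _ _ /asboolP[r ->] /asboolP[s ->]]; apply/asboolP.
  by exists 0; rewrite scale0r.
by exists (a * r + s); rewrite scalerDl scalerA.
Qed.

HB.instance Definition _ (R : nzRingType) (V : lmodType R) (x : V) :=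
  GRing.isSubmodClosed.Build R V (cyclic_submod x) (cyclic_submod_closed x).

(** The specification covers every coefficient r, not only the chosen one; this gives linearity and
    lets two such maps compose to the identity. *)
Lemma cyclic_submod_map (R : nzRingType) (A B : lmodType R) (a : A) (b : B) :
  (forall r, r *: a = 0 -> r *: b = 0) ->
  exists f : {linear submod (cyclic_submod a) -> submod (cyclic_submod b)},
    forall u r, val u = r *: a -> val (f u) = r *: b.
Proof.
move=> ab.
have gen (u : submod (cyclic_submod a)) : exists r, val u = r *: a.
  exact/asboolP/(valP u).
have [c cP] := choice gen.
have cb u : c u *: b \in cyclic_submod b by apply/asboolP; exists (c u).
pose f u : submod (cyclic_submod b) := Sub (c u *: b) (cb u).
have fE u r : val u = r *: a -> val (f u) = r *: b.
  move=> ur; apply/eqP; rewrite -subr_eq0 -scalerBl; apply/eqP/ab.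
  by rewrite scalerBl -cP ur subrr.
have fl : linear f.
  move=> k u v; apply/val_inj; rewrite (fE _ (k * c u + c v)).
    by rewrite scalerDl -scalerA.
  by rewrite scalerDl -scalerA -!cP.
pose F : {linear submod (cyclic_submod a) -> submod (cyclic_submod b)} :=
  HB.pack f (GRing.isLinear.Build R _ _ *:%R f fl).
by exists F.
Qed.

Lemma common_cyclic_submodule (R : nzRingType) (A B : lmodType R)
    (a : A) (b : B) :
  a != 0 -> (forall r, r *: a = 0 <-> r *: b = 0) -> have_common_submodule A B.
Proof.
move=> a0 ab; pose S : submodClosed A := HB.pack (cyclic_submod a).
pose T : submodClosed B := HB.pack (cyclic_submod b); exists S, T; split.
  by exists a => //; apply/asboolP; exists 1; rewrite scale1r.
have [f fE] := @cyclic_submod_map R A B a b (fun r => (ab r).1).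
have [g gE] := @cyclic_submod_map R B A b a (fun r => (ab r).2).
exists f, g => u; apply/val_inj.
  by have /asboolP[r ur] := valP u; rewrite (gE _ _ (fE _ _ ur)).
by have /asboolP[r ur] := valP u; rewrite (fE _ _ (gE _ _ ur)).
Qed.

Lemma coprime_annihilators (R : comNzRingType) (A B : lmodType R) :
  torsion_free A -> finite_rank A -> torsion_free B -> finite_rank B ->
  ~ have_common_submodule A B ->
  exists (m : nat) (r : R), [/\ (0 < m)%N, forall a : A, r *: a = 0
    & forall b : B, b *+ m = r *: b].
Proof.
move=> Atf Afr Btf Bfr nAB; apply: contrapT => nm; apply: nAB.
pose I (t : R) := exists r s : R, [/\ t = r + s, forall a : A, r *: a = 0
  & forall b : B, s *: b = 0].
have [|t _ [r [s [-> rA sB]]]||n n0 [r [s [nrs rA sB]]]|P Pprime IP] :=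
    @char0_prime_exists R I.
- move=> _ _ [r [s [-> rA sB]]] [r' [s' [-> rA' sB']]].
  exists (r + r'), (s + s'); rewrite addrACA; split=> // [a|b].
    by rewrite scalerDl rA rA' addr0.
  by rewrite scalerDl sB sB' addr0.
- exists (t * r), (t * s); rewrite mulrDr; split=> // [a|b].
    by rewrite -scalerA rA scaler0.
  by rewrite -scalerA sB scaler0.
- by exists 0, 0; split=> [|a|b]; rewrite ?addr0 ?scale0r.
- apply: nm; exists n, r; split=> // b.
  by rewrite -scaler_nat nrs scalerDl sB addr0.
have [|a aP] := prime_annihilator Pprime Atf Afr.
  move=> r rA; apply: IP; exists r, 0.
  by split=> [|//|b]; rewrite ?addr0 ?scale0r.
have [|b bP] := prime_annihilator Pprime Btf Bfr.
  move=> s sB; apply: IP; exists 0, s.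
  by split=> [|a'|//]; rewrite ?add0r ?scale0r.
apply: (@common_cyclic_submodule _ _ _ a b); last by move=> r; rewrite aP bP.
(* [a] is nonzero because 1 lies outside [P]. *)
apply/eqP => a0; apply: (@prime_nat _ _ Pprime 1%N isT).
by apply/aP; rewrite scale1r.
Qed.

Theorem propositionA (G : zmodType) (A B : lmodType (groupring G))
    (tfA : torsion_free A) (rkA : finite_rank A)
    (tfB : torsion_free B) (rkB : finite_rank B)
    (noAB : ~ have_common_submodule A B) :
  exists m : nat, (0 < m)%N /\
    forall n : nat,
      (forall x : Ext n A B, x *+ m = 0) /\ (forall x : Tor n A B, x *+ m = 0).
Proof.
have [m [r [m0 rA mB]]] := coprime_annihilators tfA rkA tfB rkB noAB.
exists m; split=> // n; split=> x.
  exact: (annihilator_Ext rA mB).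
exact: (annihilator_Tor rA mB).
Qed.
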